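(* Let $m \ge 2$ and let $L$ be an invertible linear map on $M_{m,2}$ that maps semipositive matrices to semipositive matrices. Then: (1) for $i\in\{1,2\}$, $\operatorname{rank}(L(A_i)) = 1$ whenever $A_i = \mathbf{x}\mathbf{y}_i^t$ is semipositive, where $\mathbf{x} \in \mathbb{R}^m$, $\mathbf{y}_1 = (y_1,0)^t$, $\mathbf{y}_2 = (0,y_2)^t$ with $y_1,y_2\in\mathbb{R}$; (2) there exist an invertible row positive matrix $X \in M_m$ and an inverse nonnegative matrix $Y \in M_2$ such that $L(A) = XAY$ for all $A\in M_{m,2}$.
   Context: $M_{m,n}$ is the space of real $m\times n$ matrices and $M_n = M_{n,n}$. A matrix $A\in M_{m,n}$ is semipositive if there is $x \in \mathbb{R}^n$ with $x>0$ and $Ax>0$ (componentwise strict inequalities). A matrix is row positive if it is entrywise nonnegative and every row contains at least one nonzero entry. A square matrix $Y$ is inverse nonnegative if it is invertible and $Y^{-1}$ is entrywise nonnegative. *)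

(* Defs.v *)
From mathcomp Require Import all_boot all_order all_algebra.
From mathcomp Require Import reals.

Set Implicit Arguments.
Unset Strict Implicit.
Unset Printing Implicit Defensive.

Import Order.TTheory GRing.Theory Num.Theory.
Local Open Scope ring_scope.

Definition nonneg_mx (R : realType) (m n : nat) (A : 'M[R]_(m, n)) : Prop :=
  forall i j, 0 <= A i j.

Definition semipositive (R : realType) (m n : nat) (A : 'M[R]_(m, n)) : Prop :=
  exists x : 'cV[R]_n,
    (forall j, 0 < x j 0) /\ (forall i, 0 < (A *m x) i 0).

Definition row_positive (R : realType) (m n : nat) (A : 'M[R]_(m, n)) : Prop :=
  nonneg_mx A /\ (forall i, exists j, A i j != 0).

Definition inverse_nonneg (R : realType) (n : nat) (Y : 'M[R]_n) : Prop :=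
  Y \in unitmx /\ nonneg_mx (invmx Y).

(* Main.v *)
Require Import Defs.
From mathcomp Require Import all_boot all_order all_algebra.
From mathcomp Require Import reals ring lra.

Set Implicit Arguments.
Unset Strict Implicit.
Unset Printing Implicit Defensive.

Import Order.TTheory GRing.Theory Num.Theory.
Local Open Scope ring_scope.

(** Write A = (a | b) for the two columns of A, and let T_0 a = L (a | 0) and
T_1 b = L (0 | b).

If a > 0, then (a | t b) is semipositive for every b and every real t, since
a small multiple of the second column can be absorbed by the first.  Letting t
grow, no nonnegative combination of the rows of T_1 b can have both entries
negative ([image_not_negative]); the same holds for T_0.  For an injective
linear map into the m x 2 matrices this condition is so strong that all the
images share a nonnegative null vector (1 - c, c) ([common_null_vector]): the
rows taken one at a time force each row of T b to be a multiple of a fixed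
vector, and the rows taken two at a time force these vectors to coincide.

Put the null vectors of T_1 and T_0 in the columns of a matrix Z.  It is
nonnegative, it is invertible because L is onto, and
L (a | b) Z = (X1 a | X2 b) for some invertible X1 and X2.  Semipositivity of
L (a | b) provides x > 0 with L (a | b) x > 0; with x = Z (u, v)^T this reads
u X1 a + v X2 b > 0, and u + v, the sum of the entries of x, is positive.  That
is the relation [semipositive_pair_map], which is symmetric in X1 and X2.  It
implies that X1 and X2 are nonnegative ([pair_map_nonneg]) and that X2 = mu X1
([pair_map_proportional]).  Hence L A = X1 A diag(1, mu) Z^-1, and the inverse
of diag(1, mu) Z^-1 is Z diag(1, 1/mu), which is nonnegative.

The first assertion follows from the second: multiplying the product x y_i^t
by X and Y leaves its rank at most 1, and its image is nonzero because it is
semipositive. *)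

(** * Auxiliary facts *)

Lemma ler_sum_norm (R : realType) (m : nat) (b : 'I_m -> R) (i : 'I_m) :
  - \sum_j `|b j| <= b i.
Proof.
rewrite (bigD1 i) //=.
have : 0 <= \sum_(j | j != i) `|b j| by apply: sumr_ge0.
have := lerNnormlW (lexx `|b i|).
lra.
Qed.

Lemma sum_I2 (V : nmodType) (k l : 'I_2) (F : 'I_2 -> V) :
  k != l -> \sum_j F j = F k + F l.
Proof.
move=> kl; rewrite (bigD1 k) //= (bigD1 l) //= 1?eq_sym // big1 ?addr0 //.
by move: k l kl => [[|[|//]] ?] [[|[|//]] ?] // _ [[|[|//]] ?].
Qed.

Lemma exists_neq_ord (m : nat) (i : 'I_m) : (2 <= m)%N -> exists j, j != i.
Proof.
case: m i => [|[|m]] // i _.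
have [-> | i0] := eqVneq i ord0; first by exists ord_max.
by exists ord0; rewrite eq_sym.
Qed.

Lemma linear_cV_mulmx (R : realType) (m n : nat)
  (f : {linear 'cV[R]_m -> 'cV[R]_n}) :
  exists M : 'M[R]_(n, m), forall v, f v = M *m v.
Proof.
exists (lin1_mx (trmx \o f \o trmx))^T => v.
by apply: trmx_inj; rewrite trmx_mul trmxK mul_rV_lin1 /= trmxK.
Qed.

Lemma inj_unitmx (R : realType) (m : nat) (M : 'M[R]_m) :
  (forall v : 'cV[R]_m, M *m v = 0 -> v = 0) -> M \in unitmx.
Proof.
move=> inj; rewrite -unitmx_tr -row_free_unit; apply: inj_row_free => v Mv.
apply: trmx_inj; rewrite trmx0; apply: inj.
by apply: trmx_inj; rewrite trmx_mul trmxK Mv trmx0.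
Qed.

(** * Images of matrices with a single nonzero column *)

Lemma semipositive_cols (R : realType) (m : nat) (k l : 'I_2)
  (a b : 'cV[R]_m) (s t : R) : k != l -> 0 < s -> 0 < t ->
  (forall i, 0 < s * a i 0 + t * b i 0) ->
  semipositive (a *m delta_mx 0 k + b *m delta_mx 0 l).
Proof.
move=> kl s0 t0 ab; exists (\col_j if j == k then s else t); split.
  by move=> j; rewrite mxE; case: ifP.
move=> i; rewrite mxE (sum_I2 _ kl) !mxE !big_ord1 !mxE !eqxx.
rewrite (eq_sym l k) (negPf kl) /=.
by have := ab i; lra.
Qed.

(** A positive vector x with A x > 0 gives y A x >= 0, whereas a negative row
y A would give y A x < 0. *)
Lemma semipositive_dual (R : realType) (m n : nat) (A : 'M[R]_(m, n))
  (y : 'rV[R]_m) : semipositive A -> (forall i, 0 <= y 0 i) ->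
  (0 < n)%N -> ~ (forall k, (y *m A) 0 k < 0).
Proof.
case: n A => // n A [x [x0 Ax]] y0 _ yA.
have : 0 <= (y *m (A *m x)) 0 0.
  by rewrite mxE; apply: sumr_ge0 => i _; rewrite mulr_ge0 ?y0 ?ltW ?Ax.
rewrite mulmxA mxE leNgt => /negP; apply.
rewrite big_ord_recl ltr_wnDr ?nmulr_rlt0 ?x0 //.
by apply: sumr_le0 => i _; rewrite ltW // nmulr_rlt0.
Qed.

(** Otherwise a large multiple of this image would dominate the image of the
matrix with ones in the other column, and the sum of the two, which is the
image of a semipositive matrix, would have a negative combination of rows. *)
Lemma image_not_negative (R : realType) (m : nat)
  (L : {linear 'M[R]_(m, 2) -> 'M[R]_(m, 2)}) (k : 'I_2)
  (L_semipos : forall A : 'M[R]_(m, 2), semipositive A -> semipositive (L A))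
  (y : 'rV[R]_m) (b : 'cV[R]_m) : (forall i, 0 <= y 0 i) ->
  ~ (forall j, (y *m L (b *m delta_mx 0 k)) 0 j < 0).
Proof.
move=> y0 yLb.
have [l kl] := exists_neq_ord k (leqnn 2).
pose C := L ((const_mx 1 : 'cV[R]_m) *m delta_mx 0 l).
pose yC j := (y *m C) 0 j; pose yB j := (y *m L (b *m delta_mx 0 k)) 0 j.
(* The sum is at least the threshold of either entry; adding 1 makes the
   inequality strict. *)
pose t := \sum_j `|yC j| / - yB j + 1.
have tP j : yC j + t * yB j < 0.
  have B0 : 0 < - yB j by rewrite oppr_gt0 yLb.
  have le : `|yC j| / - yB j <= \sum_j `|yC j| / - yB j.
    rewrite (bigD1 j) //= lerDl; apply: sumr_ge0 => i _.
    by rewrite divr_ge0 // oppr_ge0 ltW // yLb.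
  rewrite ler_pdivrMr // in le.
  have := ler_norm (yC j).
  rewrite /t mulrDl mul1r; lra.
have sp : semipositive ((const_mx 1 : 'cV[R]_m) *m delta_mx 0 l
                        + (t *: b) *m delta_mx 0 k).
  apply: (@semipositive_cols _ _ _ _ _ _ (1 + \sum_i `|(t *: b) i 0|) 1) => //.
    by rewrite ltr_pwDl // sumr_ge0.
  move=> i; have := ler_sum_norm (fun i => (t *: b) i 0) i.
  by rewrite [const_mx _ _ _]mxE /=; lra.
apply: (semipositive_dual (L_semipos _ sp) y0) => // j.
rewrite linearD /= -scalemxAl linearZ /= mulmxDr -scalemxAr mxE.
by rewrite [X in _ + X]mxE; apply: tP.
Qed.

(** Since the entries of a row of T b never have the same sign, the first one
vanishes whenever their difference does, so it is - c i times the difference,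
with c i in [0, 1].  The differences are coordinates H b on the domain of T.
Choosing H b = e_i - e_j and adding rows i and j gives both entries
c j - c i, so that c j < c i is impossible. *)
Lemma common_null_vector (R : realType) (m : nat) (i0 : 'I_m)
  (T : {linear 'cV[R]_m -> 'M[R]_(m, 2)}) :
  (forall b, T b = 0 -> b = 0) ->
  (forall (y : 'rV[R]_m) b, (forall i, 0 <= y 0 i) ->
     ~ (forall j, (y *m T b) 0 j < 0)) ->
  exists c : R, [/\ 0 <= c, c <= 1 &
    forall b i, (1 - c) * T b i 0 + c * T b i 1 = 0].
Proof.
move=> Tinj Tneg.
have neg (f : 'I_2 -> R) : f 0 < 0 -> f 1 < 0 -> forall j, f j < 0.
  by move=> f0 f1 [[|[|//]] p]; [move: f0 | move: f1]; congr (f _ < 0);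
     apply: val_inj.
have row1 b i : ~ (T b i 0 < 0 /\ T b i 1 < 0).
  move=> [b0 b1]; apply: (@Tneg (delta_mx 0 i) b).
    by move=> j; rewrite mxE ler0n.
  by rewrite -rowE; apply: neg; rewrite mxE.
have row2 b i j :
    ~ (T b i 0 + T b j 0 < 0 /\ T b i 1 + T b j 1 < 0).
  move=> [b0 b1]; apply: (@Tneg (delta_mx 0 i + delta_mx 0 j) b).
    by move=> k; rewrite !mxE addr_ge0 ?ler0n.
  by rewrite mulmxDl -!rowE; apply: neg; rewrite !mxE.
pose h : {linear 'M[R]_(m, 2) -> 'cV[R]_m} := col 1 \- col 0.
have [H HE] := linear_cV_mulmx (h \o T).
have HbE b i : (H *m b) i 0 = T b i 1 - T b i 0 by rewrite -HE !mxE.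
have h0 b i : (H *m b) i 0 = 0 -> T b i 0 = 0.
  rewrite HbE => e; have := row1 b i; have := row1 (- b) i.
  rewrite linearN !mxE; case: (ltgtP (T b i 0) 0) => // *; exfalso; lra.
(* If the difference of the entries is zero in each row, so are both entries. *)
have Hu : H \in unitmx.
  apply: inj_unitmx => b Hb; apply: Tinj; apply/matrixP => i j.
  have T0 : T b i 0 = 0 by apply: h0; rewrite Hb mxE.
  have T1 : T b i 1 = 0 by have := HbE b i; rewrite Hb mxE; lra.
  rewrite mxE; case: j => [[|[|//]] p].
    by rewrite -[RHS]T0; congr (T b i _); apply: val_inj.
  by rewrite -[RHS]T1; congr (T b i _); apply: val_inj.
pose beta i := invmx H *m delta_mx i 0 : 'cV[R]_m.
have Hbeta i : H *m beta i = delta_mx i 0 by rewrite mulKVmx.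
pose c i := - T (beta i) i 0.
(* The vector b - (H b)_i beta_i has i-th difference zero. *)
have T0E b i : T b i 0 = - c i * (H *m b) i 0.
  have : T (b - (H *m b) i 0 *: beta i) i 0 = 0.
    apply: h0; rewrite mulmxBr -scalemxAr Hbeta !mxE !eqxx mulr1 subrr //.
  by rewrite linearB linearZ /= !mxE /c opprK; lra.
have T1E b i : T b i 1 = (1 - c i) * (H *m b) i 0.
  by have := HbE b i; have := T0E b i; lra.
have cc i j : c i <= c j.
  have [-> // | ij] := eqVneq i j; rewrite leNgt; apply/negP => lt.
  apply: (@row2 (beta i - beta j) i j).
  rewrite !T0E !T1E mulmxBr !Hbeta !mxE !eqxx (eq_sym j i) (negPf ij) /=.
  by split; lra.
have Hbii i : (H *m beta i) i 0 = 1 by rewrite Hbeta mxE !eqxx.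
exists (c i0); split.
- rewrite leNgt; apply/negP => c0; apply: (@row1 (- beta i0) i0).
  have HN : (H *m - beta i0) i0 0 = -1 by rewrite mulmxN mxE Hbii.
  by rewrite !T0E !T1E HN; split; lra.
- rewrite leNgt; apply/negP => c0; apply: (@row1 (beta i0) i0).
  by rewrite !T0E !T1E Hbii; split; lra.
- move=> b i; rewrite T0E T1E.
  by have -> : c i = c i0 by [apply: le_anti; rewrite !cc]; ring.
Qed.

(** * Pairs of matrices acting on the two columns *)

(** The trace left on (X1, X2) when (a | b) |-> (X1 a | X2 b) Z^-1 maps
semipositive matrices to semipositive matrices.  The exact constraint on
(u, v) is Z (u, v)^T > 0; keeping only u + v > 0 makes the relation independent
of Z and symmetric in X1 and X2. *)
Definition semipositive_pair_map (R : realType) (m : nat) (X1 X2 : 'M[R]_m) :=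
  forall (a b : 'cV[R]_m) (s t : R), 0 < s -> 0 < t ->
    (forall i, 0 < s * a i 0 + t * b i 0) ->
  exists u v : R, 0 < u + v /\
    forall i, 0 < u * (X1 *m a) i 0 + v * (X2 *m b) i 0.

Lemma semipositive_pair_mapC (R : realType) (m : nat) (X1 X2 : 'M[R]_m) :
  semipositive_pair_map X1 X2 -> semipositive_pair_map X2 X1.
Proof.
move=> H a b s t s0 t0 ab.
have [|u [v [uv P]]] := H b a t s t0 s0; first by move=> i; rewrite addrC.
by exists v, u; split=> [|i]; rewrite addrC.
Qed.

(** If X1 had a negative entry, some positive a would give a negative i-th
entry of X1 a.  As X2 is onto, b can be chosen so that X2 b has i-th entry 0,
which forces u < 0 < v, and j-th entry so negative that the j-th inequality
fails. *)
Lemma pair_map_nonneg (R : realType) (m : nat) (X1 X2 : 'M[R]_m) :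
  (2 <= m)%N -> X2 \in unitmx -> semipositive_pair_map X1 X2 ->
  nonneg_mx X1.
Proof.
move=> hm X2u H i k; rewrite leNgt; apply/negP => neg.
have [j ji] := exists_neq_ord i hm.
pose s1 := (X1 *m const_mx 1 : 'cV[R]_m) i 0.
pose t := (`|s1| + 1) / - X1 i k.
have t0 : 0 <= t by rewrite divr_ge0 ?addr_ge0 // oppr_ge0 ltW.
pose a : 'cV[R]_m := const_mx 1 + t *: delta_mx k 0.
have ai : (X1 *m a) i 0 < 0.
  rewrite mulmxDr -scalemxAr -colE mxE [X in _ + X]mxE [col _ _ _ _]mxE.
  rewrite -/s1 /t invrN mulrN mulNr divfK ?lt_eqF //.
  by have := ler_norm s1; lra.
pose al := (X1 *m a) j 0.
pose b := invmx X2 *m (- `|al| *: delta_mx j 0) : 'cV[R]_m.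
have X2b : X2 *m b = - `|al| *: delta_mx j 0 by rewrite mulKVmx.
have [|//|l|u [v [uv P]]] := H a b (1 + \sum_l `|b l 0|) 1.
- by rewrite ltr_pwDl // sumr_ge0.
- have := ler_sum_norm (fun l => b l 0) l.
  have : 0 <= \sum_l `|b l 0| by rewrite sumr_ge0.
  have : 1 <= a l 0 by rewrite !mxE lerDl mulr_ge0 ?ler0n.
  by nra.
have := P i; have := P j.
have X2bi : (X2 *m b) i 0 = 0.
  by rewrite X2b !mxE eq_sym (negPf ji) mulr0.
have X2bj : (X2 *m b) j 0 = - `|al| by rewrite X2b !mxE !eqxx mulr1.
rewrite X2bi X2bj mulr0 addr0 -/al.
move=> Pj Pi.
have u0 : u < 0 by rewrite -(nmulr_lgt0 _ ai).
have : u * al <= - u * `|al|.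
  by have := lerNnormlW (lexx `|al|); nra.
have := normr_ge0 al.
by nra.
Qed.

(** Let p = X1 a and q = X2 a.  The pair (a, - r a) is a limit of pairs with a
positive combination, with weights r and 1; so, in the limit, u p >= r v q with
u + v >= 0.  Weighting rows i and j by - p_j and p_i cancels p and leaves
v <= 0 if the conclusion fails.  For small r, the j-th row then contradicts
u + v >= 0.  Instead of passing to the limit, the proof perturbs a by r g times
the all-ones vector, with g and r chosen so that |v| < u and r |q_j| is smaller
than the modulus of the perturbed p_j. *)
Lemma pair_map_cross (R : realType) (m : nat) (X1 X2 : 'M[R]_m)
  (a : 'cV[R]_m) (i j : 'I_m) :
  nonneg_mx X1 -> semipositive_pair_map X1 X2 ->
  0 < (X1 *m a) i 0 -> (X1 *m a) j 0 < 0 ->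
  (X1 *m a) i 0 * (X2 *m a) j 0 <= (X1 *m a) j 0 * (X2 *m a) i 0.
Proof.
move=> X1ge H pi pj; rewrite leNgt; apply/negP => lt.
set p := X1 *m a in pi pj lt; set q := X2 *m a in lt.
pose w := X1 *m const_mx 1 : 'cV[R]_m.
have w0 l : 0 <= w l 0.
  by rewrite mxE; apply: sumr_ge0 => k _; rewrite mxE mulr1.
pose al := - p j 0 * w i 0 + p i 0 * w j 0.
pose be := - p j 0 * q i 0 + p i 0 * q j 0.
have al0 : 0 <= al.
  by rewrite addr_ge0 // mulr_ge0 // ?oppr_ge0 ltW.
have be0 : 0 < be by rewrite /be; lra.
pose g := be / (al + 1).
have g0 : 0 < g by rewrite divr_gt0 // ltr_wpDl.
have gal : g * al <= be.
  rewrite /g mulrAC ler_pdivrMr ?ltr_wpDl // ler_pM2l //; lra.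
pose d := `|q j 0| + g * w j 0 + 1.
have d0 : 0 < d by rewrite ltr_wpDl // addr_ge0 // mulr_ge0 // ltW.
pose r := - p j 0 / d.
have r0 : 0 < r by rewrite divr_gt0 // oppr_gt0.
have rd : r * d = - p j 0 by rewrite divfK ?gt_eqF.
have [//|//|l|u [v [uv P]]] :=
    H (a + (r * g) *: const_mx 1) (- r *: a) r 1.
  have : 0 < r * (r * g) by do 2! apply: mulr_gt0 => //.
  by rewrite !mxE; lra.
have PE l : 0 < u * (p l 0 + r * g * w l 0) - v * (r * q l 0).
  have := P l; rewrite mulmxDr -!scalemxAr -/p -/q -/w.
  by rewrite [(p + _) l 0]mxE [(_ *: w) l 0]mxE [(_ *: q) l 0]mxE; lra.
have Pi := PE i; have Pj := PE j.
(* The weighted sum of rows i and j, in which the terms u p_i p_j cancel. *)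
have comb : 0 < r * (u * (g * al) - v * be).
  have : 0 < - p j 0 * (u * (p i 0 + r * g * w i 0) - v * (r * q i 0)) +
             p i 0 * (u * (p j 0 + r * g * w j 0) - v * (r * q j 0)).
    by rewrite addr_gt0 // mulr_gt0 // oppr_gt0.
  by rewrite /al /be; lra.
rewrite (pmulr_rgt0 _ r0) in comb.
have gal0 : 0 <= g * al by rewrite mulr_ge0 // ltW.
(* With 0 <= g al <= be: u <= 0 would give v < 0, against u + v > 0. *)
have u0 : 0 < u.
  rewrite ltNge; apply/negP => u0.
  have : v * be <= 0 by nra.
  rewrite (pmulr_lle0 _ be0); lra.
have vu : v < u by rewrite -(ltr_pM2r be0); nra.
have vq : - v * q j 0 <= u * `|q j 0|.
  have nv : `|v| <= u by rewrite ler_norml; lra.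
  apply: le_trans (ler_norm _) _; rewrite normrM normrN.
  by apply: ler_wpM2r.
have : u * (p j 0 + r * d) = 0 by rewrite rd subrr mulr0.
have : r * (- v * q j 0) <= r * (u * `|q j 0|) by rewrite ler_pM2l.
have : 0 < u * r by rewrite mulr_gt0.
rewrite /d; lra.
Qed.

(** Applying the previous inequality to a and to - a gives
p_i q_j = p_j q_i whenever p_i and p_j have opposite signs.  For M = X2 X1^-1
and p = x e_i - y e_j, the choices (1, 1), (1, 2) and (2, 1) of (x, y) give
three independent linear equations in M j i, M i j and M i i - M j j, so M is
scalar. *)
Lemma pair_map_proportional (R : realType) (m : nat) (X1 X2 : 'M[R]_m) :
  (0 < m)%N -> X1 \in unitmx -> nonneg_mx X1 -> semipositive_pair_map X1 X2 ->
  exists mu, X2 = mu *: X1.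
Proof.
move=> m0 X1u X1ge H.
have cross (a : 'cV[R]_m) i j : 0 < (X1 *m a) i 0 -> (X1 *m a) j 0 < 0 ->
    (X1 *m a) i 0 * (X2 *m a) j 0 = (X1 *m a) j 0 * (X2 *m a) i 0.
  move=> pi pj; apply: le_anti; rewrite (pair_map_cross X1ge H) //=.
  have := @pair_map_cross _ _ _ _ (- a) j i X1ge H.
  have N (X : 'M[R]_m) l : (X *m - a) l 0 = - (X *m a) l 0.
    by rewrite mulmxN mxE.
  by rewrite !N !mulrNN oppr_gt0 oppr_lt0; apply.
pose M := X2 *m invmx X1.
have ME i j (x y : R) : i != j -> 0 < x -> 0 < y ->
    x * (x * M j i - y * M j j) = - y * (x * M i i - y * M i j).
  move=> ij x0 y0.
  pose p : 'cV[R]_m := x *: delta_mx i 0 - y *: delta_mx j 0.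
  have MpE l : (M *m p) l 0 = x * M l i - y * M l j.
    by rewrite mulmxBr -!scalemxAr -!colE !mxE.
  have := @cross (invmx X1 *m p) i j.
  rewrite mulKVmx // mulmxA -/M !MpE !mxE !eqxx (eq_sym j i) (negPf ij) /=.
  rewrite !mulr0 !mulr1 subr0 sub0r; apply; lra.
have Mscal i j : i != j -> M i j = 0 /\ M i i = M j j.
  move=> ij.
  have := @ME i j 1 1 ij; have := @ME i j 1 2 ij; have := @ME i j 2 1 ij.
  move=> /(_ ltac:(lra) ltac:(lra)) e1 /(_ ltac:(lra) ltac:(lra)) e2.
  move=> /(_ ltac:(lra) ltac:(lra)) e3.
  split; lra.
exists (M (Ordinal m0) (Ordinal m0)).
rewrite -[LHS](mulmxKV X1u) -/M -mul_scalar_mx; congr (_ *m _).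
apply/matrixP => i j; rewrite [RHS]mxE.
have [<- | ij] := eqVneq i j; last by have [] := Mscal _ _ ij.
by have [<- // | /Mscal[]] := eqVneq i (Ordinal m0).
Qed.

(** * The factorization *)

Lemma col_expansion (R : realType) (m : nat) (A : 'M[R]_(m, 2)) :
  A = col 0 A *m delta_mx 0 0 + col 1 A *m delta_mx 0 1.
Proof.
apply/matrixP => i j; rewrite !mxE !big_ord1 !mxE /=.
by case: j => [[|[|//]] p]; rewrite /= ?mulr1 ?mulr0 ?addr0 ?add0r;
   congr (A i _); apply: val_inj.
Qed.

Lemma linear_into_semipositive_factor (R : realType) (m : nat)
  (hm : (2 <= m)%N) (L : {linear 'M[R]_(m, 2) -> 'M[R]_(m, 2)}) :
  bijective L ->
  (forall A : 'M[R]_(m, 2), semipositive A -> semipositive (L A)) ->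
  exists (X : 'M[R]_m) (Y : 'M[R]_2),
     [/\ X \in unitmx, row_positive X, inverse_nonneg Y
       & forall A : 'M[R]_(m, 2), L A = X *m A *m Y].
Proof.
move=> Lbij Lsp; have m0 : (0 < m)%N by apply: ltn_trans hm.
pose i0 := Ordinal m0.
pose T k : {linear 'cV[R]_m -> 'M[R]_(m, 2)} :=
  L \o mulmxr (delta_mx 0 k : 'rV[R]_2).
have TE k b : T k b = L (b *m delta_mx 0 k) by [].
have Tinj k b : T k b = 0 -> b = 0.
  rewrite TE -[RHS](linear0 L) => /(bij_inj Lbij) /matrixP e.
  apply/colP => i; have := e i k.
  by rewrite !mxE big_ord1 !mxE !eqxx mulr1.
have [c [c0 c1 cT]] := common_null_vector i0 (@Tinj 1)
  (fun y b y0 => image_not_negative Lsp y0 (b := b)).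
have [d [d0 d1 dT]] := common_null_vector i0 (@Tinj 0)
  (fun y b y0 => image_not_negative Lsp y0 (b := b)).
(* Column 0 of Z kills the images of the second column, column 1 those of the
   first, so that in L A *m Z the two columns of A become separated. *)
pose Z : 'M[R]_2 := \matrix_(i, j)
  (if j == 0 then if i == 0 then 1 - c else c
   else if i == 0 then 1 - d else d).
have Zge : nonneg_mx Z.
  move=> i j; rewrite mxE.
  by case: ifP => _; case: ifP => _ //; rewrite subr_ge0.
have MZ (B : 'M[R]_(m, 2)) i :
  (B *m Z) i 0 = (1 - c) * B i 0 + c * B i 1 /\
  (B *m Z) i 1 = (1 - d) * B i 0 + d * B i 1.
  by rewrite !mxE !(@sum_I2 _ 0 1) // !mxE /=; split; ring.
have addE (M N : 'M[R]_(m, 2)) i j : (M + N) i j = M i j + N i j.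
  by rewrite mxE.
(* If c = d, the vector (1 - c, c) would kill every L B; but L is onto. *)
have cd : c != d.
  apply/eqP => cd.
  have [B BE] : exists B, L B = const_mx 1.
    by have [g _ Lg] := Lbij; exists (g (const_mx 1)).
  have := dT (col 0 B) i0; have := cT (col 1 B) i0.
  have := congr1 (fun M : 'M_(m, 2) => M i0 0) BE.
  have := congr1 (fun M : 'M_(m, 2) => M i0 1) BE.
  rewrite {1 2}(col_expansion B) linearD -!TE cd.
  rewrite !addE ![const_mx _ _ _]mxE; nra.
have Zu : Z \in unitmx.
  apply: inj_unitmx => v Zv.
  have := congr1 (fun M : 'cV_2 => M 0 0) Zv.
  have := congr1 (fun M : 'cV_2 => M 1 0) Zv.
  rewrite !mxE !(@sum_I2 _ 0 1) // !mxE /= => e1 e0.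
  have v0 : v 0 0 = 0.
    have : (c - d) * v 0 0 = 0 by nra.
    by move/eqP; rewrite mulf_eq0 subr_eq0 (negPf cd) => /eqP.
  have v1 : v 1 0 = 0 by move: e0 e1; rewrite v0; lra.
  apply/colP; case=> [[|[|//]] p]; rewrite mxE.
    by rewrite -[RHS]v0; congr (v _ _); apply: val_inj.
  by rewrite -[RHS]v1; congr (v _ _); apply: val_inj.
have [X1 X1E] := linear_cV_mulmx (col 0 \o (mulmxr Z \o T 0)).
have [X2 X2E] := linear_cV_mulmx (col 1 \o (mulmxr Z \o T 1)).
have T0Z a : T 0 a *m Z = (X1 *m a) *m delta_mx 0 0.
  apply/matrixP => i j; rewrite -X1E [RHS]mxE big_ord1.
  rewrite [col _ _ _ _]mxE [delta_mx _ _ _ _]mxE /=.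
  case: j => [[|[|//]] p].
    by rewrite mulr1; congr ((_ *m _) i _); apply: val_inj.
  rewrite mulr0 -[RHS](dT a i).
  by have [_ <-] := MZ (T 0 a) i; congr ((_ *m _) i _); apply: val_inj.
have T1Z b : T 1 b *m Z = (X2 *m b) *m delta_mx 0 1.
  apply/matrixP => i j; rewrite -X2E [RHS]mxE big_ord1.
  rewrite [col _ _ _ _]mxE [delta_mx _ _ _ _]mxE /=.
  case: j => [[|[|//]] p]; last first.
    by rewrite mulr1; congr ((_ *m _) i _); apply: val_inj.
  rewrite mulr0 -[RHS](cT b i).
  by have [<- _] := MZ (T 1 b) i; congr ((_ *m _) i _); apply: val_inj.
have X1u : X1 \in unitmx.
  apply: inj_unitmx => a Xa; apply: (Tinj 0).
  by rewrite -(mulmxK Zu (T 0 a)) T0Z Xa !mul0mx.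
have X2u : X2 \in unitmx.
  apply: inj_unitmx => b Xb; apply: (Tinj 1).
  by rewrite -(mulmxK Zu (T 1 b)) T1Z Xb !mul0mx.
have pair : semipositive_pair_map X1 X2.
  move=> a b s t s0 t0 ab.
  have [//|x [x0 Lx]] := Lsp _ (@semipositive_cols _ _ 0 1 _ _ _ _ _ s0 t0 ab).
  have [u xE] : exists u, x = Z *m u.
    by exists (invmx Z *m x); rewrite mulKVmx.
  exists (u 0 0), (u 1 0); split.
    have : 0 < x 0 0 + x 1 0 by rewrite addr_gt0.
    by rewrite xE !mxE !(@sum_I2 _ 0 1) // !mxE /=; lra.
  move=> i; have := Lx i.
  rewrite linearD -!TE xE mulmxA mulmxDl T0Z T1Z.
  rewrite mxE (@sum_I2 _ 0 1) // !addE.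
  rewrite ![(_ *m delta_mx _ _) i _]mxE !big_ord1 ![delta_mx _ _ _ _]mxE /=.
  lra.
have X1ge := pair_map_nonneg hm X2u pair.
have X2ge := pair_map_nonneg hm X1u (semipositive_pair_mapC pair).
have [mu X2mu] := pair_map_proportional m0 X1u X1ge pair.
have rowX1 i : exists j, X1 i j != 0.
  apply/existsP; apply: contraT; rewrite negb_exists => /forallP X1i.
  have := mulmxV X1u => /matrixP /(_ i i).
  rewrite !mxE eqxx big1 => [/eqP|j _]; first by rewrite eq_sym oner_eq0.
  by have := X1i j; rewrite negbK => /eqP ->; rewrite mul0r.
have mu_gt0 : 0 < mu.
  rewrite lt_neqAle; apply/andP; split.
    apply/eqP => mu0; have := mulmxV X2u.
    rewrite X2mu -mu0 scale0r mul0mx => /matrixP /(_ i0 i0) /eqP.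
    by rewrite !mxE eqxx eq_sym oner_eq0.
  have [j Xj] := rowX1 i0.
  have Xj0 : 0 < X1 i0 j by rewrite lt_neqAle eq_sym Xj X1ge.
  by have := X2ge i0 j; rewrite X2mu mxE pmulr_lge0.
pose D (r : R) : 'M[R]_2 := diag_mx (\row_j if j == 0 then 1 else r).
have DD : D mu *m D mu^-1 = 1%:M.
  apply/matrixP => i j; rewrite mul_diag_mx !mxE.
  case: ifP => _; first by case: (i == j); rewrite mul1r.
  by case: (i == j); rewrite ?mulr0 // mulr1n divff // gt_eqF.
pose Y := D mu *m invmx Z.
have YW : Y *m (Z *m D mu^-1) = 1%:M by rewrite mulmxA mulmxKV.
have [Yu _] := mulmx1_unit YW.
exists X1, Y; split=> //.
- split=> //.
  have -> : invmx Y = Z *m D mu^-1 by rewrite -[LHS]mulmx1 -YW mulKmx.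
  move=> i j; rewrite mul_mx_diag mxE; apply: mulr_ge0 => //; rewrite mxE.
  by case: ifP => // _; rewrite invr_ge0 ltW.
- move=> A; rewrite -(mulmxK Zu (L A)) mulmxA; congr (_ *m _).
  have rowD k : (delta_mx 0 k : 'rV[R]_2) *m D mu =
      (if k == 0 then 1 else mu) *: delta_mx 0 k.
    apply/rowP => j; rewrite mul_mx_diag !mxE mulrC /=.
    by case: (eqVneq j k) => [-> // | _]; rewrite !mulr0.
  rewrite [in LHS](col_expansion A) [in RHS](col_expansion A).
  rewrite linearD mulmxDl -!TE T0Z T1Z X2mu mulmxDr mulmxDl !mulmxA.
  rewrite -![_ *m delta_mx _ _ *m D mu]mulmxA !rowD /= scale1r.
  by rewrite -!scalemxAl -scalemxAr.
Qed.

Theorem theorem3p6 (R : realType) (m : nat) (hm : (2 <= m)%N)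
  (L : {linear 'M[R]_(m, 2) -> 'M[R]_(m, 2)})
  (L_inv : bijective L)
  (L_semipos : forall A : 'M[R]_(m, 2), semipositive A -> semipositive (L A)) :
  (forall (i : 'I_2) (x : 'cV[R]_m) (y : R),
     let yi : 'cV[R]_2 := y *: delta_mx i 0 in
     semipositive (x *m yi^T) -> \rank (L (x *m yi^T)) = 1%N)
  /\
  (exists (X : 'M[R]_m) (Y : 'M[R]_2),
     [/\ X \in unitmx, row_positive X, inverse_nonneg Y
       & forall A : 'M[R]_(m, 2), L A = X *m A *m Y]).
Proof.
have [X [Y [Xu Xpos Yinv LE]]] :=
  linear_into_semipositive_factor hm L_inv L_semipos.
split; last by exists X, Y.
move=> i x y yi /L_semipos [v [_ Lv]].
apply/eqP; rewrite eqn_leq lt0n mxrank_eq0; apply/andP; split.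
  rewrite LE !mulmxA -mulmxA.
  exact: leq_trans (mxrankM_maxr _ _) (rank_leq_row _).
have m0 : (0 < m)%N by apply: ltn_trans hm.
apply/eqP => L0; have := Lv (Ordinal m0).
by rewrite L0 mul0mx mxE ltxx.
Qed.
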